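(* Let $\{(x^k,\lambda^k)\}\subset X\times H$ be an infinite sequence generated by the safeguarded augmented Lagrangian method (ALM) described in the context, and suppose that the subproblems are solved in such a way that there is a sequence $\{\varepsilon^k\}\subset X^*$ with $\varepsilon^k\rightharpoonup^*0$, $x^{k+1}\in C$ and $\varepsilon^{k+1}-(L_{\rho^k})'_x(x^{k+1},w^k)\in\mathcal N_C(x^{k+1})$ for all $k\ge0$. Assume that $f'\colon X\to X^*$ is weak-to-weak* sequentially continuous. Suppose that the sequence $\{x^k\}$ admits a feasible weak accumulation point $\bar x\in\mathcal F$ (i.e., a subsequence of $\{x^k\}$ converges weakly to $\bar x\in\mathcal F$) that is w-AKKT regular. Then $\bar x$ is a KKT point of the problem $(P)$: minimize $f(x)$ over $x\in C$ subject to $G(x)\in K$.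
   Context: Setting: $X$ and $Y$ are real Banach spaces, $f\colon X\to\mathbb R$ and $G\colon X\to Y$ are continuously Fréchet differentiable, $C\subset X$ and $K\subset Y$ are nonempty, closed, convex sets, $\mathcal F:=\{x\in C\mid G(x)\in K\}$. $H$ is a real Hilbert space (identified with its dual), $e\colon Y\to H$ is a continuous dense embedding, giving $Y\hookrightarrow H=H^*\hookrightarrow Y^*$ (so $\lambda\in H$ acts on $Y$ by $\langle\lambda,y\rangle_Y=(\lambda,e(y))_H$), and $\mathcal K\subset H$ is a closed convex set with $e^{-1}(\mathcal K)=K$. The embedding $e$ is omitted from the notation below. $d_{\mathcal K}$ and $P_{\mathcal K}$ denote the distance function and projection of $\mathcal K$ in $H$. For a closed convex set $S$, $\mathcal N_S(x):=\{v\mid\langle v,z-x\rangle\le0\ \forall z\in S\}$ (in the dual space) for $x\in S$, $\mathcal N_S(x):=\varnothing$ otherwise. Weak-to-weak* sequential continuity of $f'$: $x^k\rightharpoonup x$ implies $f'(x^k)\rightharpoonup^*f'(x)$. Augmented Lagrangian: for $\rho>0$, $x\in X$, $\lambda\in H$, $L_\rho(x,\lambda):=f(x)+\frac\rho2 d_{\mathcal K}^2\left(G(x)+\frac\lambda\rho\right)-\frac{\|\lambda\|_H^2}{2\rho}$. Put $V(x,\lambda,\rho):=\|G(x)-P_{\mathcal K}(G(x)+\rho^{-1}\lambda)\|_H$. ALM: given $(x^0,\lambda^0)\in X\times H$, $\rho^0>0$, a nonempty bounded set $B\subset H$, $\gamma>1$, $\tau\in(0,1)$. For $k=0,1,2,\dots$: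 (the iteration is assumed not to terminate) choose $w^k\in B$ and compute an approximate solution $x^{k+1}$ of the subproblem: minimize $L_{\rho^k}(x,w^k)$ over $x\in C$; set $\lambda^{k+1}:=\rho^k\left[G(x^{k+1})+\frac{w^k}{\rho^k}-P_{\mathcal K}\left(G(x^{k+1})+\frac{w^k}{\rho^k}\right)\right]$; let $V^{k+1}:=V(x^{k+1},w^k,\rho^k)$ and set $\rho^{k+1}:=\rho^k$ if $k=0$ or $V^{k+1}\le\tau V^k$, and $\rho^{k+1}:=\gamma\rho^k$ otherwise. KKT point: $\bar x\in\mathcal F$ is a KKT point of $(P)$ if there is $\bar\lambda\in Y^*$ with $-f'(\bar x)-G'(\bar x)^*\bar\lambda\in\mathcal N_C(\bar x)$ and $\bar\lambda\in\mathcal N_K(G(\bar x))$. For $x\in X$ and $r\ge0$ let $\mathcal M(x,r):=\{G'(x)^*\lambda+\mu\in X^*\mid\lambda\in Y^*,\ \mu\in\mathcal N_C(x),\ \langle\lambda,y-G(x)\rangle_Y\le r\ \forall y\in K\}$. A point $\bar x\in\mathcal F$ is w-AKKT regular if every $\bar v\in X^*$ for which there exist $\{x^k\}\subset X$, $\{r^k\}\subset[0,+\infty)$, $\{v^k\}\subset X^*$ with $x^k\rightharpoonup\bar x$, $r^k\to0$, $v^k\rightharpoonup^*\bar v$ and $v^k\in\mathcal M(x^k,r^k)$ for all $k$ belongs to $\mathcal M(\bar x,0)$. *)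

(* Defs.v *)
From HB Require Import structures.
From mathcomp Require Import all_boot all_order all_algebra.
From mathcomp Require Import sesquilinear.
From mathcomp Require Import all_classical all_reals all_analysis.

Set Implicit Arguments.
Unset Strict Implicit.
Unset Printing Implicit Defensive.

Import Order.TTheory GRing.Theory Num.Theory.
Import numFieldNormedType.Exports.

Local Open Scope classical_set_scope.
Local Open Scope ring_scope.

Section Duality.
Context {R : realType} {X : normedModType R}.

(* The dual space is carved out of X -> R as a set, so that sums, opposites and
   the pairing <v, h> = v h are the pointwise ones. *)
Definition dual : set (X -> R) := [set v : X -> R | scalar v /\ continuous v].

Definition weak_cvg (x_ : nat -> X) (x : X) : Prop :=
  forall v, dual v -> v (x_ k) @[k --> \oo] --> v x.

Definition weak_star_cvg (v_ : nat -> X -> R) (v : X -> R) : Prop :=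
  forall h, v_ k h @[k --> \oo] --> v h.

Definition normal_cone (S : set X) (x : X) : set (X -> R) :=
  [set v | [/\ S x, dual v & forall z, S z -> v (z - x) <= 0]].

Definition weak_accumulation_point (x_ : nat -> X) (x : X) : Prop :=
  exists2 n_ : nat -> nat, increasing_seq n_ & weak_cvg (x_ \o n_) x.

End Duality.

Section Calculus.
Context {R : realType} {V W : normedModType R}.

(* Meaningful only for bounded linear L: sup of an unbounded set is 0. *)
Definition op_norm (L : V -> W) : R :=
  sup [set `|L h| | h in [set h : V | `|h| <= 1]].

Definition continuously_differentiable (F : V -> W) : Prop :=
  (forall x, differentiable F x) /\
  (forall x, op_norm ('d F y \- 'd F x) @[y --> x] --> (0 : R)).

End Calculus.

Definition weak_to_weak_star_sequentially_continuous_derivative {R : realType}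
    {X : normedModType R} (f : X -> R) : Prop :=
  forall x_ x, weak_cvg x_ x -> weak_star_cvg (fun k => 'd f (x_ k)) ('d f x).

Section Hilbert.
Context {R : realType} {H : normedModType R}.

Definition induces_norm (ip : {dot H for @idfun R}) : Prop :=
  forall u : H, `|u| = Num.sqrt (ip u u).

Definition dist_to (S : set H) (u : H) : R := inf [set `|u - z| | z in S].

(* The nearest point of S to u, chosen by [get] (an arbitrary point of H if
   there is none). *)
Definition proj_on (S : set H) (u : H) : H :=
  get [set p | S p /\ forall z, S z -> `|u - p| <= `|u - z|].

Definition dense_embedding {Y : normedModType R} (e : {linear Y -> H}) : Prop :=
  [/\ injective e, continuous e & dense (range e)].

End Hilbert.

Section Problem.
Context {R : realType} {X Y : normedModType R}.
Variables (f : X -> R) (G : X -> Y) (C : set X) (K : set Y).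

Definition feasible : set X := [set x | C x /\ K (G x)].

Definition KKT_point (x : X) : Prop :=
  feasible x /\
  exists lam : Y -> R, [/\ dual lam,
    normal_cone C x (fun h => - 'd f x h - lam ('d G x h)) &
    normal_cone K (G x) lam].

Definition AKKT_cone (x : X) (r : R) : set (X -> R) :=
  [set v | exists (lam : Y -> R) (mu : X -> R),
    [/\ dual lam, normal_cone C x mu,
        forall y, K y -> lam (y - G x) <= r &
        v = (fun h => lam ('d G x h) + mu h)]].

Definition wAKKT_regular (x : X) : Prop :=
  feasible x /\
  forall v : X -> R, dual v ->
    (exists (x_ : nat -> X) (r_ : nat -> R) (v_ : nat -> X -> R),
      [/\ weak_cvg x_ x,
          forall k, 0 <= r_ k,
          r_ k @[k --> \oo] --> (0 : R),
          forall k, dual (v_ k) &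
          weak_star_cvg v_ v] /\
      forall k, AKKT_cone (x_ k) (r_ k) (v_ k)) ->
    AKKT_cone x 0 v.

End Problem.

Section AugmentedLagrangian.
Context {R : realType} {X Y H : normedModType R}.
Variables (f : X -> R) (G : X -> Y) (e : Y -> H) (calK : set H).

Definition aug_lagrangian (rho : R) (x : X) (lam : H) : R :=
  f x + rho / 2 * dist_to calK (e (G x) + rho^-1 *: lam) ^+ 2
  - `|lam| ^+ 2 / (2 * rho).

Definition aug_lagrangian_dx (rho : R) (x : X) (lam : H) : X -> R :=
  'd (fun x' => aug_lagrangian rho x' lam) x.

Definition ALM_V (x : X) (lam : H) (rho : R) : R :=
  `|e (G x) - proj_on calK (e (G x) + rho^-1 *: lam)|.

(* The iterates (x_, lam_), the safeguarded multipliers w_ and the penalty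
   parameters rho_ of the method with parameters B, gamma, tau.  The value
   V^k used in the penalty update at iteration k >= 1 is
   V(x^k, w^(k-1), rho^(k-1)).  How x^(k+1) approximately solves its
   subproblem is not part of this record. *)
Record ALM_sequence (B : set H) (gamma tau : R) (x_ : nat -> X)
    (lam_ w_ : nat -> H) (rho_ : nat -> R) : Prop := {
  ALM_rho0 : 0 < rho_ 0%N ;
  ALM_B_nonempty : B !=set0 ;
  ALM_B_bounded : bounded_set B ;
  ALM_gamma : 1 < gamma ;
  ALM_tau : 0 < tau < 1 ;
  ALM_w : forall k, B (w_ k) ;
  ALM_lam : forall k,
    let p := e (G (x_ k.+1)) + (rho_ k)^-1 *: w_ k in
    lam_ k.+1 = rho_ k *: (p - proj_on calK p) ;
  ALM_rho_first : rho_ 1%N = rho_ 0%N ;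
  ALM_rho : forall k,
    rho_ k.+2 =
      if ALM_V (x_ k.+2) (w_ k.+1) (rho_ k.+1)
         <= tau * ALM_V (x_ k.+1) (w_ k) (rho_ k)
      then rho_ k.+1 else gamma * rho_ k.+1
}.

End AugmentedLagrangian.

(* Main.v *)
(** By the variational inequality for the projection, [dist_to calK ^+ 2] is
    Frechet differentiable with derivative [2 (u - P u, .)], so the stationarity
    condition reads [eps^k - f'(x^k) = mu + G'(x^k)^* lam^k] with
    [mu \in N_C(x^k)].  The same inequality, with [s = G(x^k) - P(...)] and
    [lam^k = rho s + w], bounds [lam^k(y - G(x^k))] for [y \in K] by
    [-(w, s) - rho |s|^2 <= |w| V - rho V^2], whose positive part tends to 0
    whether or not the penalty parameters stay bounded.  Hence
    [eps^k - f'(x^k)] lies in the AKKT cones, converges weakly-* to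
    [-f'(xbar)] along the subsequence, and w-AKKT regularity concludes. *)

Require Import Defs.
From HB Require Import structures.
From mathcomp Require Import all_boot all_order all_algebra.
From mathcomp Require Import sesquilinear.
From mathcomp Require Import all_classical all_reals all_analysis.
From mathcomp Require Import ring lra.

Set Implicit Arguments.
Unset Strict Implicit.
Unset Printing Implicit Defensive.

Import Order.TTheory GRing.Theory Num.Theory.
Import numFieldNormedType.Exports.

Local Open Scope classical_set_scope.
Local Open Scope ring_scope.

(** * Inner-product identities and Cauchy-Schwarz in [H] *)

Section DotNorm.
Context {R : realType} {H : normedModType R} (ip : {dot H for @idfun R}).
Hypothesis hip : induces_norm ip.

Lemma dotC u v : ip u v = ip v u.
Proof. by rewrite hermC expr0 mul1r. Qed.

Lemma dot_scalar u : scalar (ip u).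
Proof. by move=> a v w; rewrite linearPr. Qed.

Lemma dotZr a u v : ip u (a *: v) = a * ip u v.
Proof. exact: linearZr_LR. Qed.

Lemma dotZl a u v : ip (a *: u) v = a * ip u v.
Proof. by rewrite dotC dotZr dotC. Qed.

Lemma dotDl u v w : ip (u + v) w = ip u w + ip v w.
Proof. by rewrite linearDl. Qed.

Lemma dot_normE u : ip u u = `|u| ^+ 2.
Proof.
rewrite hip sqr_sqrtr//; have [->|/neq0_dnorm_gt0/ltW//] := eqVneq u 0.
by rewrite linear0r.
Qed.

Lemma sqr_normD u v : `|u + v| ^+ 2 = `|u| ^+ 2 + 2 * ip u v + `|v| ^+ 2.
Proof. by rewrite -!dot_normE hnormD /= expr0; ring. Qed.

Lemma sqr_normB u v : `|u - v| ^+ 2 = `|u| ^+ 2 - 2 * ip u v + `|v| ^+ 2.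
Proof. by rewrite sqr_normD normrN linearNr; ring. Qed.

(** The norm of [H] already satisfies the triangle inequality; squaring it and expanding both sides
    leaves exactly Cauchy-Schwarz. *)
Lemma dot_le_norm u v : ip u v <= `|u| * `|v|.
Proof.
have : `|u + v| ^+ 2 <= (`|u| + `|v|) ^+ 2.
  by rewrite ler_pXn2r ?nnegrE ?addr_ge0//; exact: ler_normD.
by rewrite sqr_normD sqrrD; lra.
Qed.

Lemma norm_dot_le u v : `|ip u v| <= `|u| * `|v|.
Proof.
rewrite ler_norml dot_le_norm andbT lerNl -linearNl.
by rewrite (le_trans (dot_le_norm _ _))// normrN.
Qed.

Lemma dot_continuous u : continuous (ip u).
Proof.
move=> v; apply/cvgrPdist_le => eps eps0; near=> w.
rewrite -linearBr (le_trans (norm_dot_le _ _))//.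
rewrite (@le_trans _ _ ((`|u| + 1) * `|v - w|))//.
  by rewrite ler_wpM2r// lerDl.
rewrite mulrC -ler_pdivlMr ?ltr_wpDl//; near: w.
by apply: cvgr_dist_le => //; rewrite divr_gt0// ltr_wpDl.
Unshelve. all: by end_near. Qed.

Lemma dot_dual u : dual (ip u).
Proof. by split; [exact: dot_scalar|exact: dot_continuous]. Qed.

End DotNorm.

(** * Dual functionals and differentials *)

Lemma dual_comp {R : realType} {X Y : normedModType R} (v : Y -> R)
    (A : {linear X -> Y}) : dual v -> continuous A -> dual (v \o A).
Proof.
move=> [lv cv] cA; split; first by move=> a x y /=; rewrite linearP lv.
by move=> x; apply: continuous_comp; [exact: cA|exact: cv].
Qed.

Lemma dualZ {R : realType} {X : normedModType R} a (v : X -> R) :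
  dual v -> dual (fun x => a * v x).
Proof.
move=> [lv cv]; split; first by move=> b x y /=; rewrite lv; ring.
by move=> x; apply: cvgM; [exact: cvg_cst|exact: cv].
Qed.

Lemma dualB {R : realType} {X : normedModType R} (v w : X -> R) :
  dual v -> dual w -> dual (fun x => v x - w x).
Proof.
move=> [lv cv] [lw cw]; split; first by move=> b x y /=; rewrite lv lw; ring.
by move=> x; apply: cvgB; [exact: cv|exact: cw].
Qed.

Lemma dual_diff {R : realType} {X : normedModType R} (f : X -> R) x :
  differentiable f x -> dual ('d f x).
Proof.
move=> df; split; first by move=> a y z; rewrite linearP.
exact: diff_continuous.
Qed.

(** A quadratic remainder is [o(h)], so uniqueness of the differential identifies it with [v],
    packed as a linear map. *)
Lemma is_diff_sqr_remainder {R : realType} {X : normedModType R} (f v : X -> R)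
    (x : X) : dual v ->
  (forall h, `|f (x + h) - f x - v h| <= `|h| ^+ 2) -> is_diff x f v.
Proof.
move=> [lv cv] fv.
pose A : {linear X -> R} := HB.pack v (GRing.isLinear.Build R X R _ v lv).
have fA : f \o shift x = cst (f x) + A +o_ 0 id.
  apply/eqaddoP => eps eps0; apply: filterS (nbhs0_le eps0) => h /= heps.
  rewrite [X in `|X|](_ : _ = f (x + h) - f x - v h); last first.
    by rewrite !fctE/= (addrC h) opprD addrA.
  by rewrite (le_trans (fv _))// expr2 ler_wpM2r.
have dA := diff_unique (cv : continuous A) fA.
by split => //; apply/diff_locallyP; rewrite dA.
Qed.

(** * Distance to, and projection onto, a closed convex set *)

Lemma dist_to_ge0 {R : realType} {H : normedModType R} (S : set H) u :
  0 <= dist_to S u.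
Proof.
have [->|S0] := eqVneq S set0; first by rewrite /dist_to image_set0 inf0.
apply: lb_le_inf => [|_ [z _ <-]//].
by have /set0P[z Sz] := S0; exists `|u - z|, z.
Qed.

Lemma dist_to_le {R : realType} {H : normedModType R} (S : set H) u z :
  S z -> dist_to S u <= `|u - z|.
Proof.
by move=> Sz; apply: ge_inf; [exists 0 => _ [y _ <-]|exists z].
Qed.

Lemma dist_to_adherent {R : realType} {H : normedModType R} (S : set H) u r :
  S !=set0 -> dist_to S u < r -> exists2 z, S z & `|u - z| < r.
Proof.
move=> [z0 Sz0] ltr; rewrite -subr_gt0 in ltr.
have [|_ [z Sz <-]] := inf_adherent ltr (_ : has_inf [set `|u - z| | z in S]).
  by split; [exists `|u - z0|, z0|exists 0 => _ [y _ <-]].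
by rewrite -/(dist_to S u) subrKC => zr; exists z.
Qed.

Lemma convex_set_conv {R : realType} {H : normedModType R} (S : set H)
    (t : R) x y : @convex_set R H S -> 0 <= t <= 1 -> S x -> S y ->
  S (x + t *: (y - x)).
Proof.
move=> cS t01 Sx Sy; have /andP[t0 t1] := t01.
have := cS y x (Itv01 t0 t1).
rewrite !inE => /(_ Sy Sx).
rewrite [X in S X -> _](_ : _ = x + t *: (y - x))//.
rewrite -[LHS]/(t *: y + (1 - t) *: x) scalerBl scale1r scalerBr.
by rewrite addrCA.
Qed.

Section Projection.
Context {R : realType} {H : completeNormedModType R}.
Context (ip : {dot H for @idfun R}).
Hypothesis hip : induces_norm ip.
Variable S : set H.
Hypotheses (S0 : S !=set0) (S_closed : closed S).
Hypothesis (S_convex : @convex_set R H S).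

(** Parallelogram law: the midpoint of [z] and [z'] lies in [S] by convexity, hence is at distance
    at least [dist_to S u] from [u]. This makes minimizing sequences Cauchy. *)
Lemma sqr_norm_minimizing_le u z z' a a' : S z -> S z' ->
  `|u - z| ^+ 2 <= dist_to S u ^+ 2 + a ->
  `|u - z'| ^+ 2 <= dist_to S u ^+ 2 + a' ->
  `|z - z'| ^+ 2 <= 2 * (a + a').
Proof.
move=> Sz Sz' za z'a.
have half01 : 0 <= (2^-1 : R) <= 1 by lra.
have /(dist_to_le u) := convex_set_conv S_convex half01 Sz Sz'.
rewrite -(@ler_pXn2r _ 2) ?nnegrE ?dist_to_ge0//.
have -> : u - (z + 2^-1 *: (z' - z)) = 2^-1 *: ((u - z) + (u - z')).
  have -> : z' - z = (u - z) - (u - z') by rewrite opprB [RHS]addrC addrA subrK.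
  rewrite opprD addrA; move: (u - z) (u - z') => b b'.
  rewrite scalerBr scalerDr opprB -[X in X + _]scale1r.
  have {1}-> : 1 = 2^-1 + 2^-1 :> R by lra.
  by rewrite scalerDl addrACA subrr addr0.
rewrite normrZ ger0_norm// exprMn (sqr_normD hip) => mid.
have -> : z - z' = (u - z') - (u - z) by rewrite opprB [RHS]addrC addrA subrK.
rewrite (sqr_normB hip) (dotC ip (u - z')).
by move: mid za z'a; lra.
Qed.

Lemma nearest_point_exists u :
  exists p, S p /\ forall z, S z -> `|u - p| <= `|u - z|.
Proof.
pose d := dist_to S u.
have /choice[z_ Sz] n :
    exists z, S z /\ `|u - z| ^+ 2 <= d ^+ 2 + harmonic n.
  have hn := harmonic_gt0 n : 0 < (harmonic n : R).
  have d0 : 0 <= d by exact: dist_to_ge0.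
  have ltd : d < Num.sqrt (d ^+ 2 + harmonic n).
    by rewrite -[ltLHS]ger0_norm// -sqrtr_sqr ltr_sqrt ?ltrDl// ltr_wpDl// sqr_ge0.
  have [z ? /ltW zd] := dist_to_adherent S0 ltd.
  exists z; split=> //.
  rewrite -[leRHS]sqr_sqrtr ?addr_ge0 ?sqr_ge0 ?(ltW hn)//.
  by rewrite ler_pXn2r ?nnegrE.
have z_cvg : cvg (z_ @ \oo).
  apply: cauchy_cvg; apply: cauchy_exP => eps eps0.
  (* Two slacks below [eps ^+ 2 / 4] give a squared distance below [2 * (eps ^+ 2 / 4 + eps ^+ 2 /
     4) = eps ^+ 2]. *)
  have /cvgrPdist_lt/(_ (eps ^+ 2 / 4)) := @cvg_harmonic R.
  rewrite divr_gt0 ?exprn_gt0// => /(_ isT) [N _ Nh].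
  exists (z_ N), N => // n /= Nn.
  rewrite -ball_normE/= -(@ltr_pXn2r _ 2) ?nnegrE ?(ltW eps0)//.
  have := sqr_norm_minimizing_le (Sz N).1 (Sz n).1 (Sz N).2 (Sz n).2.
  move: (Nh _ (leqnn N)) (Nh _ Nn).
  rewrite !sub0r !normrN !ger0_norm ?harmonic_ge0//; lra.
exists (lim (z_ @ \oo)); split.
  apply: (@closed_cvg _ _ \oo _ z_ S S_closed _ _ z_cvg).
  by apply: nearW => n; exact: (Sz n).1.
move=> z Sz'; apply: le_trans (dist_to_le u Sz').
rewrite -(@ler_pXn2r _ 2) ?nnegrE ?dist_to_ge0//.
apply: (@ler_cvg_to _ \oo _ _ (fun n => `|u - z_ n| ^+ 2)
  (fun n => d ^+ 2 + harmonic n)).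
- by rewrite expr2; apply: cvgM; apply: cvg_norm; apply: cvgB => //; exact: cvg_cst.
- rewrite -[X in _ --> X]addr0; apply: cvgD; first exact: cvg_cst.
  exact: cvg_harmonic.
- by apply: nearW => n; exact: (Sz n).2.
Qed.

Lemma proj_onP u :
  S (proj_on S u) /\ forall z, S z -> `|u - proj_on S u| <= `|u - z|.
Proof.
have [p pP] := nearest_point_exists u.
exact: (@getPex _ [set p | S p /\ forall z, S z -> `|u - p| <= `|u - z|])
  (ex_intro _ p pP).
Qed.

Lemma proj_on_in u : S (proj_on S u). Proof. exact: (proj_onP u).1. Qed.

Lemma dist_to_proj u : dist_to S u = `|u - proj_on S u|.
Proof.
apply/eqP; rewrite eq_le dist_to_le/=; last exact: proj_on_in.
apply: lb_le_inf; first by case: S0 => z Sz; exists `|u - z|, z.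
by move=> _ [z Sz <-]; exact: (proj_onP u).2.
Qed.

(** If [i > 0], moving from [p] a little towards [z] would stay in [S] and come strictly closer to
    [u]. *)
Lemma proj_on_variational u z :
  S z -> ip (u - proj_on S u) (z - proj_on S u) <= 0.
Proof.
move=> Sz; set p := proj_on S u; set i := ip _ _; rewrite leNgt; apply/negP => i0.
pose n := `|z - p| ^+ 2; have n0 : 0 <= n by exact: sqr_ge0.
(* This step length lies in [0, 1] and satisfies [t * n = i - t * i], so the change
   [t ^+ 2 * n - 2 * t * i] of the squared distance equals [- t * i - t ^+ 2 * i < 0]. *)
pose t := i / (i + n); have in0 : 0 < i + n by rewrite ltr_pwDl.
have t01 : 0 <= t <= 1.
  by rewrite divr_ge0 ?(ltW i0) ?(ltW in0)// ler_pdivrMr// mul1r lerDl.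
have := (proj_onP u).2 _ (convex_set_conv S_convex t01 (proj_on_in u) Sz).
rewrite -/p -(@ler_pXn2r _ 2) ?nnegrE// opprD addrA.
rewrite (sqr_normB hip (u - p)) dotZr -/i normrZ exprMn -/n ger0_norm; last first.
  by case/andP: t01.
have t0 : 0 < t by rewrite divr_gt0.
have -> : t ^+ 2 * n = t * (i - t * i).
  by rewrite /t; move: in0; clearbody i n => in0; field; rewrite lt0r_neq0.
have : 0 < t * i by rewrite mulr_gt0.
have : 0 <= t * (t * i) by rewrite !(mulr_ge0, ltW).
lra.
Qed.

(* With [p], [q] the projections of [u] and [u + h], minimality of [q] gives
   [`|u + h - q|^2 <= `|u + h - p|^2], and the variational inequality at [p]
   tested with [q] gives the matching lower bound. *)
Lemma is_diff_sqr_dist_to u :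
  is_diff u (fun v => dist_to S v ^+ 2) (fun h => 2 * ip (u - proj_on S u) h).
Proof.
apply: is_diff_sqr_remainder => [|h]; first exact/dualZ/(dot_dual hip).
set p := proj_on S u; set q := proj_on S (u + h).
have up : dist_to S (u + h) ^+ 2 <= `|(u - p) + h| ^+ 2.
  rewrite ler_pXn2r ?nnegrE ?dist_to_ge0//.
  by rewrite addrAC dist_to_le//; exact: proj_on_in.
rewrite (sqr_normD hip) in up.
have low : dist_to S (u + h) ^+ 2 = `|(u - p) + (h - (q - p))| ^+ 2.
  rewrite dist_to_proj; congr (`| _ | ^+ 2).
  by rewrite opprB [RHS]addrACA addKr.
rewrite (sqr_normD hip) linearBr in low.
have := proj_on_variational u (proj_on_in (u + h)); rewrite -/p -/q => var.
have := sqr_ge0 `|h - (q - p)|.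
rewrite ler_norml (dist_to_proj u) -/p; move: up; rewrite low.
by move: var => /= var up sq; apply/andP; split; lra.
Qed.

End Projection.

(** * The penalty update rule *)

Section SafeguardedPenalty.
Context {R : realType} (rho V : nat -> R) (gamma tau : R).
Hypotheses (rho0 : 0 < rho 0%N) (gamma1 : 1 < gamma) (tau01 : 0 < tau < 1).
Hypothesis V_ge0 : forall k, 0 <= V k.
Hypothesis rho1 : rho 1%N = rho 0%N.
Hypothesis rhoS : forall k, rho k.+2 =
  if V k.+1 <= tau * V k then rho k.+1 else gamma * rho k.+1.

Lemma penalty_gt0 k : 0 < rho k.
Proof.
suff: 0 < rho k /\ 0 < rho k.+1 by case.
elim: k => [|k [_ IH]]; first by rewrite rho1.
split=> //; rewrite rhoS; case: ifPn => // _.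
by rewrite mulr_gt0// (lt_trans _ gamma1).
Qed.

Lemma penalty_nondecreasing : nondecreasing_seq rho.
Proof.
apply/nondecreasing_seqP => -[|k]; first by rewrite rho1.
rewrite rhoS; case: ifPn => // _.
by rewrite ler_peMl ?(ltW gamma1)// ltW// penalty_gt0.
Qed.

(** A bounded penalty sequence converges, so its increments vanish. Every genuine increase is at
    least [(gamma - 1) * rho 0], so eventually the test always succeeds and [V] decays geometrically
    with ratio [tau]. *)
Lemma bounded_penalty_cvg0 :
  has_ubound (range rho) -> V k @[k --> \oo] --> (0 : R).
Proof.
move=> /(nondecreasing_is_cvgn penalty_nondecreasing) rho_cvg.
have rho_diff : rho k.+1 - rho k @[k --> \oo] --> (0 : R).
  rewrite -(subrr (lim (rho @ \oo))); apply: cvgB => //.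
  by rewrite -/([sequence rho n.+1]_n @ \oo) cvg_shiftS.
have gap0 : 0 < (gamma - 1) * rho 0%N by rewrite mulr_gt0// subr_gt0.
have /cvgrPdist_lt/(_ _ gap0)[N _ Ngap] := rho_diff.
have decay k : (N <= k)%N -> V k.+1 <= tau * V k.
  move=> Nk; have /= := Ngap k.+1 (leqW Nk).
  rewrite rhoS; case: ifPn => // _; rewrite sub0r normrN => small.
  have rho0k : rho 0%N <= rho k.+1 by exact: penalty_nondecreasing.
  have : (gamma - 1) * rho 0%N <= (gamma - 1) * rho k.+1.
    by rewrite ler_wpM2l// subr_ge0 ltW.
  by move: small; rewrite ltr_norml; lra.
have geom n : V (n + N)%N <= geometric (V N) tau n.
  elim: n => [|n IH]; first by rewrite /= add0n expr0 mulr1.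
  rewrite addSn (le_trans (decay _ (leq_addl _ _)))//.
  rewrite /= exprS mulrCA ler_wpM2l//; by case/andP: tau01 => /ltW.
rewrite -(cvg_shiftn N).
apply: (@squeeze_cvgr _ _ _ _ (cst 0) (geometric (V N) tau)).
- by apply: nearW => n; rewrite V_ge0 geom.
- exact: cvg_cst.
- by apply: cvg_geometric; case/andP: tau01 => ? ?; rewrite gtr0_norm.
Qed.

(* If the penalty parameter is bounded, [V] tends to 0; otherwise completing the
   square bounds the expression by [M ^+ 2 / (4 * rho k)]. *)
Lemma safeguarded_bound_cvg0 M : 0 <= M ->
  Num.max 0 (M * V k - rho k * V k ^+ 2) @[k --> \oo] --> (0 : R).
Proof.
move=> M0; have [rho_bd|rho_ubd] := pselect (has_ubound (range rho)).
  apply: (@squeeze_cvgr _ _ _ _ (cst 0) (fun k => M * V k)).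
  - apply: nearW => k; rewrite le_max lexx/= ge_max mulr_ge0//= gerBl.
    by rewrite mulr_ge0 ?sqr_ge0// ltW// penalty_gt0.
  - exact: cvg_cst.
  - rewrite -(mulr0 M); apply: cvgM; [exact: cvg_cst|].
    exact: bounded_penalty_cvg0.
apply/cvgrPdist_le => eps eps0.
(* Beyond this threshold [M ^+ 2 / (4 * rho k)] is at most [eps]. *)
have [N rhoN] : exists N, M ^+ 2 / (4 * eps) <= rho N.
  apply: contrapT => no; apply: rho_ubd; exists (M ^+ 2 / (4 * eps)).
  move=> _ [k _ <-]; rewrite leNgt; apply/negP => /ltW lek.
  by apply: no; exists k.
exists N => // k /= Nk; rewrite sub0r normrN ger0_norm ?le_max ?lexx//.
rewrite ge_max (ltW eps0)/=.
have rhok := penalty_gt0 k.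
have : M ^+ 2 / (4 * eps) <= rho k.
  by rewrite (le_trans rhoN)// penalty_nondecreasing.
rewrite ler_pdivrMr ?mulr_gt0// => rhoM.
rewrite -(ler_pM2l (_ : 0 < 4 * rho k)) ?mulr_gt0//.
(* Expanded, this square says [4 * rho k * (M * V k - rho k * V k ^+ 2) <= M ^+ 2]. *)
have := sqr_ge0 (2 * (rho k * V k) - M); nra.
Qed.

End SafeguardedPenalty.

(** By induction [k <= n_ k], so the indices tend to infinity. *)
Lemma increasing_seq_cvg_comp {T : topologicalType} (u : nat -> T) (l : T)
    (n_ : nat -> nat) : increasing_seq n_ ->
  u k @[k --> \oo] --> l -> u (n_ k) @[k --> \oo] --> l.
Proof.
move=> n_incr ul; apply: (cvg_comp n_ u _ ul) => A [N _ NA].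
exists N => // k /= Nk; apply: NA => /=; apply: (leq_trans Nk).
elim: k {Nk} => // k IH; apply: (leq_ltn_trans IH).
by have /increasing_seqP := n_incr; apply.
Qed.

(** * Derivative of the augmented Lagrangian and the multiplier estimate *)

Section AugmentedLagrangian.
Context {R : realType} {X Y : normedModType R} {H : completeNormedModType R}.
Context (ip : {dot H for @idfun R}) (f : X -> R) (G : X -> Y).
Context (e : {linear Y -> H}) (S : set H).
Hypotheses (hip : induces_norm ip) (e_continuous : continuous e).
Hypotheses (S0 : S !=set0) (S_closed : closed S).
Hypothesis (S_convex : @convex_set R H S).

(** Chain rule: the factor 2 from the squared distance cancels against [rho / 2], leaving the
    updated multiplier as the coefficient. *)
Lemma aug_lagrangian_dxE rho x w h : 0 < rho ->
  differentiable f x -> differentiable G x ->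
  let p := e (G x) + rho^-1 *: w in
  aug_lagrangian_dx f G e S rho x w h =
  'd f x h + ip (rho *: (p - proj_on S p)) (e ('d G x h)).
Proof.
move=> rho_gt0 df dG p.
have de : is_diff (G x) e e.
  by split; [exact: linear_differentiable|exact: diff_lin].
have dp : is_diff x ((e \o G) + cst (rho^-1 *: w)) (e \o 'd G x).
  have dfG := differentiableP dG; apply: is_diff_eq.
  by rewrite addr0.
have dd : is_diff ((e \o G + cst (rho^-1 *: w)) x) (fun v => dist_to S v ^+ 2)
    (fun k => 2 * ip (p - proj_on S p) k).
  exact: is_diff_sqr_dist_to.
have dff := differentiableP df.
rewrite /aug_lagrangian_dx.
have dL : is_diff x (fun x' => aug_lagrangian f G e S rho x' w)
    (('d f x : X -> R) + (rho / 2) *: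
       ((fun k => 2 * ip (p - proj_on S p) k) \o (e \o 'd G x))).
  have -> : (fun x' => aug_lagrangian f G e S rho x' w) =
    f + (rho / 2) *: ((fun v => dist_to S v ^+ 2) \o
        (e \o G + cst (rho^-1 *: w))) - cst (`|w| ^+ 2 / (2 * rho)) by [].
  by apply: is_diff_eq; rewrite subr0.
rewrite diff_val !fctE/= dotZl; congr (_ + _).
by rewrite /GRing.scale/=; field.
Qed.

(** Split [z - y] at the projection [q]: the variational inequality handles [z - q], while
    [rho *: (y - q) + w] paired with [y - q] is estimated by Cauchy-Schwarz. *)
Lemma multiplier_le rho w y z p : 0 < rho -> S z -> p = y + rho^-1 *: w ->
  ip (rho *: (p - proj_on S p)) (z - y) <=
  `|w| * `|y - proj_on S p| - rho * `|y - proj_on S p| ^+ 2.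
Proof.
move=> rho_gt0 Sz pE; set q := proj_on S p.
have lamE : rho *: (p - q) = rho *: (y - q) + w.
  rewrite pE addrAC scalerDr scalerA divff ?scale1r//.
  by rewrite gt_eqF.
have -> : z - y = (z - q) - (y - q) by rewrite opprB addrA subrK.
rewrite linearBr/=.
have : ip (rho *: (p - q)) (z - q) <= 0.
  rewrite dotZl mulr_ge0_le0 ?(ltW rho_gt0)//.
  exact: proj_on_variational.
have : - ip w (y - q) <= `|w| * `|y - q|.
  by rewrite (le_trans _ (norm_dot_le hip _ _))// -normrN ler_norm.
rewrite lamE !dotDl !dotZl dot_normE//.
lra.
Qed.

End AugmentedLagrangian.

Theorem corollary7p6 (R : realType)
  (* the problem (P) *)
  (X Y : completeNormedModType R) (f : X -> R) (G : X -> Y)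
  (C : set X) (K : set Y)
  (hf : continuously_differentiable f) (hG : continuously_differentiable G)
  (C_nonempty : C !=set0) (C_closed : closed C) (C_convex : @convex_set R X C)
  (K_nonempty : K !=set0) (K_closed : closed K) (K_convex : @convex_set R Y K)
  (* the Hilbert space H, the embedding e and the set calK *)
  (H : completeNormedModType R) (ip : {dot H for @idfun R})
  (hip : induces_norm ip)
  (e : {linear Y -> H}) (he : dense_embedding e)
  (calK : set H) (calK_closed : closed calK)
  (calK_convex : @convex_set R H calK) (calK_K : e @^-1` calK = K)
  (* the sequence generated by the method *)
  (B : set H) (gamma tau : R) (x_ : nat -> X) (lam_ w_ : nat -> H)
  (rho_ : nat -> R)
  (hALM : ALM_sequence G e calK B gamma tau x_ lam_ w_ rho_)
  (* the inexact solution of the subproblems *)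
  (eps_ : nat -> X -> R) (eps_dual : forall k, dual (eps_ k))
  (eps_cvg : weak_star_cvg eps_ (fun=> 0))
  (x_in_C : forall k, C (x_ k.+1))
  (x_stationary : forall k, normal_cone C (x_ k.+1)
    (fun h => eps_ k.+1 h
              - aug_lagrangian_dx f G e calK (rho_ k) (x_ k.+1) (w_ k) h))
  (f'_cont : weak_to_weak_star_sequentially_continuous_derivative f)
  (xbar : X) (xbar_acc : weak_accumulation_point x_ xbar)
  (xbar_feasible : feasible G C K xbar)
  (xbar_regular : wAKKT_regular G C K xbar) :
  KKT_point f G C K xbar.
Proof.
have [_ e_cont _] := he.
have calK0 : calK !=set0.
  by case: K_nonempty => y; rewrite -calK_K => Ky; exists (e y).
have [M M_ge0 w_le] : exists2 M, 0 <= M & forall k, `|w_ k| <= M.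
  have /ex_strict_bound_gt0[M M_gt0 BM] := ALM_B_bounded hALM.
  by exists M => [|k]; apply: ltW => //; apply: BM; exact: ALM_w hALM k.
(* Shifted index: this [V k] is the quantity written V^(k+1) in the method. *)
pose V k := ALM_V G e calK (x_ k.+1) (w_ k) (rho_ k).
have V_ge0 k : 0 <= V k by exact: normr_ge0.
have rho_gt0 := penalty_gt0 (ALM_rho0 hALM) (ALM_gamma hALM)
  (ALM_rho_first hALM) (ALM_rho hALM : forall k, rho_ k.+2 =
    if V k.+1 <= tau * V k then rho_ k.+1 else gamma * rho_ k.+1).
have r_cvg := safeguarded_bound_cvg0 (ALM_rho0 hALM) (ALM_gamma hALM)
  (ALM_tau hALM) V_ge0 (ALM_rho_first hALM) (ALM_rho hALM) M_ge0.
(* Truncated at 0 because the slacks in w-AKKT regularity must be nonnegative. *)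
pose r k := Num.max 0 (M * V k - rho_ k * V k ^+ 2).
have stationary k : AKKT_cone G C K (x_ k.+1) (r k)
    (fun h => eps_ k.+1 h - 'd f (x_ k.+1) h).
  (* The multiplier in [H] acts on [Y] through [e]; the normal vector is the one supplied by the
     stationarity condition. *)
  exists (ip (lam_ k.+1) \o e), (fun h => eps_ k.+1 h
    - aug_lagrangian_dx f G e calK (rho_ k) (x_ k.+1) (w_ k) h); split => //.
  - exact/dual_comp/e_cont/dot_dual.
  - move=> y; rewrite -calK_K => Ky /=; rewrite linearB (ALM_lam hALM).
    apply: (le_trans (multiplier_le hip calK0 calK_closed calK_convex
      (rho_gt0 k) Ky erefl)).
    by rewrite le_max lerD2r ler_wpM2r ?orbT.
  - apply/funext => h /=.
    rewrite (aug_lagrangian_dxE hip e_cont calK0 calK_closed calK_convex)//.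
    + by rewrite (ALM_lam hALM); ring.
    + exact: hf.1.
    + exact: hG.1.
have [n_ n_incr x_cvg] := xbar_acc.
(* Stationarity is available only from [x_ 1] on. Dropping the first term of the subsequence makes
   every index positive, hence a successor. *)
pose m k := (n_ k.+1).-1.
have mS k : (m k).+1 = n_ k.+1.
  rewrite prednK// (leq_ltn_trans (leq0n (n_ k)))//.
  by have /increasing_seqP := n_incr; apply.
have mS_incr : increasing_seq (fun k => (m k).+1).
  by move=> j k; rewrite !mS n_incr.
have m_incr : increasing_seq m by move=> j k; rewrite -mS_incr.
have xm_cvg : weak_cvg (fun k => x_ (m k).+1) xbar.
  move=> v /x_cvg; rewrite -(cvg_shiftS (fun k => v (x_ (n_ k)))).
  by under [X in X @ _]eq_fun do rewrite -mS.
have epsm_cvg h : eps_ (m k).+1 h @[k --> \oo] --> (0 : R).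
  exact: (increasing_seq_cvg_comp mS_incr (eps_cvg h)).
have df_dual : dual (fun h => - 'd f xbar h).
  have [lf cf] := dual_diff (hf.1 xbar).
  split; first by move=> a y z; rewrite lf; ring.
  by move=> y; apply: cvgN; exact: cf.
(* Regularity is applied to [- 'd f xbar]; the limiting slack 0 makes [lam] normal to [K] at
   [G xbar]. *)
have [|lam [mu [lam_dual mu_normal lam_le dfE]]] := xbar_regular.2 _ df_dual.
  exists (fun k => x_ (m k).+1), (r \o m),
    (fun k h => eps_ (m k).+1 h - 'd f (x_ (m k).+1) h).
  split; last by move=> k; exact: stationary.
  split=> //.
  - by move=> k; rewrite le_max lexx.
  - exact: (increasing_seq_cvg_comp m_incr r_cvg).
  - by move=> k; apply: dualB => //; apply: dual_diff; exact: hf.1.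
  - move=> h; rewrite -sub0r; apply: cvgB; first exact: epsm_cvg.
    exact: (f'_cont _ _ xm_cvg).
split=> //; exists lam; split=> //.
  (* Rearranging the decomposition of [- 'd f xbar] identifies this functional with [mu]. *)
  rewrite [X in normal_cone _ _ X](_ : _ = mu)//.
  by apply/funext => h; rewrite (congr1 (fun g => g h) dfE); ring.
by split=> //; exact: xbar_feasible.2.
Qed.
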